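(* Let $n\ge 2$ and let $(g_2,\dots,g_n)$ be a tower. For $1\le k\le n$, the word $M_k$ is a palindrome in the letters $g_2,\dots,g_k$.
   Context: Permutations in $S_n$ are multiplied as functions: $(\pi g)(i)=\pi(g(i))$. For $1\le k\le n$, $G_k=\mathrm{Sym}\{1,\dots,k\}$ is the subgroup of $S_n$ of permutations fixing each of $k+1,\dots,n$. A $k$-cycle on $\{1,\dots,k\}$ is an element of $G_k$ that is a single cycle of length $k$. A tower is a sequence $(g_2,\dots,g_n)$ with $g_k\in G_k\setminus G_{k-1}$ such that, setting $g_1:=\mathbf 1$, each $u_k:=g_{k-1}^{-1}g_k$ is a $k$-cycle on $\{1,\dots,k\}$ $(2\le k\le n)$. Words over the alphabet $\{g_2,\dots,g_n\}$: $M_1=\varepsilon$ (empty word) and $M_k=(M_{k-1}\,g_k)^{k-1}M_{k-1}$ for $2\le k\le n$. A palindrome is a word equal to its reversal. *)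

(* Defs.v *)
From mathcomp Require Import all_boot all_fingroup.

Set Implicit Arguments.
Unset Strict Implicit.
Unset Printing Implicit Defensive.

Import GroupScope.

(* The point i : 'I_n stands for i + 1 in {1, ..., n}, so this is {1, ..., k}. *)
Definition initial_segment (n k : nat) : {set 'I_n} := [set i : 'I_n | (i < k)%N].

Definition G_ (n k : nat) : {set 'S_n} := Sym (initial_segment n k).

(* [porbits c] is the set of (supports of) cycles of [c], fixed points
   included. *)
Definition is_full_cycle (n k : nat) (c : 'S_n) : bool :=
  (c \in G_ n k) && (initial_segment n k \in porbits c).

(* A sequence (g_2, ..., g_n) is encoded as a function on nat, of which only the
   values at 2, ..., n are used. *)
Definition with_g1 (n : nat) (g : nat -> 'S_n) (k : nat) : 'S_n :=
  if (k <= 1)%N then 1 else g k.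

(* MathComp composes permutations left to right, (s * t) i = t (s i), so the
   product g_{k-1}^{-1} g_k of functions is [g k * (g k.-1)^-1] here. *)
Definition step (n : nat) (g : nat -> 'S_n) (k : nat) : 'S_n :=
  with_g1 g k * (with_g1 g k.-1)^-1.

Definition is_tower (n : nat) (g : nat -> 'S_n) : Prop :=
  forall k : nat, (2 <= k <= n)%N ->
    g k \in G_ n k :\: G_ n k.-1 /\ is_full_cycle k (step g k).

Definition word_pow (T : Type) (w : seq T) (m : nat) : seq T :=
  flatten (nseq m w).

(* M_1 is the empty word; the value at 0 is junk. *)
Fixpoint M_ (T : Type) (g : nat -> T) (k : nat) : seq T :=
  match k with
  | 0 | 1 => [::]
  | (_.+1 as k').+1 => word_pow (rcons (M_ g k') (g k)) k' ++ M_ g k'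
  end.

Definition palindrome (T : Type) (w : seq T) : Prop := w = rev w.

Definition word_in_letters (T : Type) (g : nat -> T) (k : nat) (w : seq T) : Prop :=
  exists js : seq nat, all (fun j => (2 <= j <= k)%N) js /\ w = map g js.

(* Main.v *)
Require Import Defs.
From mathcomp Require Import all_boot all_fingroup.

(** The palindrome property is purely combinatorial. If [w] is a palindrome and
    [a] a letter, then [(w a)^m w] reads as [w], [a], [w], [a], ..., [w], with
    [m.+1] copies of [w] separated by single letters [a]; this pattern is
    symmetric, and so is each of its pieces. Formally, reversal turns
    [(w a)^m w] into [w (a w)^m], which is the same word by re-bracketing
    ([word_pow_conj]). Induction on [k] then shows that [M_ g k] is a palindrome.

    For the letters, [M_] commutes with substitution of letters ([map_M_]), so
    [M_ g k] is the image under [g] of the word [M_ id k] of indices, and it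
    suffices to bound the indices that occur in the latter. *)

Lemma rev_word_pow (T : Type) (w : seq T) (m : nat) :
  rev (word_pow w m) = word_pow (rev w) m.
Proof. by rewrite /word_pow rev_flatten map_nseq rev_nseq. Qed.

Lemma map_word_pow (T U : Type) (f : T -> U) (w : seq T) (m : nat) :
  map f (word_pow w m) = word_pow (map f w) m.
Proof. by rewrite /word_pow map_flatten map_nseq. Qed.

Lemma all_word_pow (T : Type) (p : pred T) (w : seq T) (m : nat) :
  all p w -> all p (word_pow w m).
Proof.
by move=> pw; rewrite /word_pow; elim: m => //= m IHm; rewrite all_cat pw.
Qed.

(** Both sides are the alternating word [u v u v ... u]. *)
Lemma word_pow_conj (T : Type) (u v : seq T) (m : nat) :
  word_pow (u ++ v) m ++ u = u ++ word_pow (v ++ u) m.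
Proof.
rewrite /word_pow; elim: m => [|m IHm] /=; first by rewrite cats0.
by rewrite -catA IHm !catA.
Qed.

Lemma palindrome_word_pow_rcons (T : Type) (w : seq T) (a : T) (m : nat) :
  palindrome w -> palindrome (word_pow (rcons w a) m ++ w).
Proof.
move=> pal_w; rewrite /palindrome rev_cat rev_word_pow rev_rcons -pal_w.
by rewrite -cats1 word_pow_conj.
Qed.

Lemma palindrome_M_ (T : Type) (g : nat -> T) (k : nat) : palindrome (M_ g k).
Proof.
elim: k => [|[|k] IHk] //.
exact: palindrome_word_pow_rcons IHk.
Qed.

Lemma map_M_ (T U : Type) (f : T -> U) (g : nat -> T) (k : nat) :
  map f (M_ g k) = M_ (f \o g) k.
Proof.
elim: k => [|[|k] IHk] //.
by rewrite [LHS]map_cat map_word_pow map_rcons IHk.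
Qed.

Lemma all_M_id (k : nat) : all (fun j => 2 <= j <= k) (M_ id k).
Proof.
elim: k => [|[|k] IHk] //.
have {}IHk : all (fun j => 2 <= j <= k.+2) (M_ id k.+1).
  by apply: sub_all IHk => j /andP[-> /leqW].
rewrite [M_ id _]/= all_cat IHk andbT.
by apply: all_word_pow; rewrite all_rcons IHk leqnn.
Qed.

Theorem lemma3p2 (n : nat) (hn : (2 <= n)%N) (g : nat -> 'S_n)
    (hg : is_tower g) (k : nat) (hk : (1 <= k <= n)%N) :
  palindrome (M_ g k) /\ word_in_letters g k (M_ g k).
Proof.
split; first exact: palindrome_M_.
by exists (M_ id k); split; [exact: all_M_id | rewrite map_M_].
Qed.
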